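(* Let $G$ be a finite group of order $|G|=\ell$, let $2\leq q\leq \ell$, let $X$ be a free $G$-space and let $Y$ be a Hausdorff space. The triple $(X,G;Y)$ does not satisfy the $q$-th Borsuk-Ulam property if and only if there exists a $G$-equivariant map $X\to F(Y,\ell,q)$.
   Context: ''Space'' means topological space and ''map'' means continuous map. A free $G$-space is a Hausdorff space $X$ on which the finite group $G$ acts freely on the left. The triple $(X,G;Y)$ satisfies the $q$-th Borsuk-Ulam property ($q$-th BUP) if for every map $f:X\to Y$ there exist a point $x\in X$ and distinct $u_1,\ldots,u_q\in G$ such that $f(u_1x)=\cdots=f(u_qx)$. The configuration-like space $F(Y,\ell,q)\subset Y^\ell$ (subspace topology) is the set of all $(y_1,\ldots,y_\ell)\in Y^\ell$ such that for any indices $0<i_1<\cdots<i_q\leq\ell$ at least two of $y_{i_1},\ldots,y_{i_q}$ are different. Fix an enumeration $G=\{g_1,\ldots,g_\ell\}$ and let $h:G\to\{1,\ldots,\ell\}$ be the bijection $h(g_j)=j$. The group $G$ acts on the left on $Y^\ell$ by $g(y_1,\ldots,y_\ell)=(y_{h(g^{-1}g_1)},\ldots,y_{h(g^{-1}g_\ell)})$, and this action restricts to a left action on $F(Y,\ell,q)$. *)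

(* Defs.v *)
From HB Require Import structures.
From mathcomp Require Import all_boot all_fingroup.
From mathcomp Require Import all_classical topology.

Set Implicit Arguments.
Unset Strict Implicit.
Unset Printing Implicit Defensive.

Local Open Scope classical_set_scope.

(* MathComp's [action] is a right action, hence this record for left ones. *)
Record left_action (G : finGroupType) (T : Type) := LeftAction {
  lact :> G -> T -> T;
  lact1 : forall x : T, lact 1%g x = x;
  lactM : forall (g k : G) (x : T), lact (g * k)%g x = lact g (lact k x)
}.

Definition free_G_space (G : finGroupType) (X : topologicalType)
    (act : left_action G X) : Prop :=
  [/\ hausdorff_space X,
      forall g : G, continuous (act g) &
      forall (g : G) (x : X), act g x = x -> g = 1%g].

Definition equivariant (G : finGroupType) (S T : Type)
    (actS : left_action G S) (actT : left_action G T) (f : S -> T) : Prop :=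
  forall (g : G) (x : S), f (actS g x) = actT g (f x).

Definition BUP (G : finGroupType) (X Y : topologicalType)
    (act : left_action G X) (q : nat) : Prop :=
  forall f : X -> Y, continuous f ->
    exists (x : X) (u : 'I_q -> G),
      injective u /\ forall a b : 'I_q, f (act (u a) x) = f (act (u b) x).

(* Y^l with the product topology; coordinates are numbered from 0. *)
Definition cart_power (Y : topologicalType) (l : nat) :=
  prod_topology (fun _ : 'I_l => Y).

Definition config (Y : topologicalType) (l q : nat) : set (cart_power Y l) :=
  [set y | forall i : 'I_q -> 'I_l,
     (forall a b : 'I_q, (a < b)%N -> (i a < i b)%N) ->
     exists a b : 'I_q, y (i a) <> y (i b)].
Arguments config : clear implicits.

(* As a type, [config Y l q] is [set_type (config Y l q)], which the library
   equips with the subspace topology. *)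
Definition config_space (Y : topologicalType) (l q : nat) : topologicalType :=
  set_type (config Y l q).

(* The enumeration j |-> g_j of G, with its inverse h. *)
Record enumeration (G : finGroupType) (l : nat) := Enumeration {
  elt : 'I_l -> G;
  idx : G -> 'I_l;
  eltK : cancel elt idx;
  idxK : cancel idx elt
}.

Section Action.
Variables (G : finGroupType) (Y : topologicalType) (l : nat).
Variable e : enumeration G l.

Definition shift (g : G) (j : 'I_l) : 'I_l := idx e (g^-1 * elt e j)%g.

Definition power_act (g : G) (y : cart_power Y l) : cart_power Y l :=
  fun j => y (shift g j).

Lemma shift_inj (g : G) : injective (shift g).
Proof.
by move=> j k /(can_inj (idxK e))/mulgI/(can_inj (eltK e)).
Qed.

Lemma power_act1 (y : cart_power Y l) : power_act 1%g y = y.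
Proof.
by apply: funext => j; rewrite /power_act /shift invg1 mul1g eltK.
Qed.

Lemma power_actM (g k : G) (y : cart_power Y l) :
  power_act (g * k)%g y = power_act g (power_act k y).
Proof.
by apply: funext => j; rewrite /power_act /shift idxK invMg mulgA.
Qed.

Definition power_action : left_action G (cart_power Y l) :=
  LeftAction power_act1 power_actM.

Lemma config_injP (q : nat) (y : cart_power Y l) :
  config Y l q y <-> forall i : 'I_q -> 'I_l, injective i ->
    exists a b : 'I_q, y (i a) <> y (i b).
Proof.
split=> Fy i Hi; last first.
  apply: Fy => a b iab; apply/val_inj/eqP; rewrite eqn_leq.
  by apply/andP; split; rewrite leqNgt; apply/negP => /Hi; rewrite iab ltnn.
set S := [set i a | a in 'I_q]%SET.
have cS : #|S| = q by rewrite card_imset // card_ord.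
pose s (a : 'I_q) : 'I_l := enum_val (cast_ord (esym cS) a).
have s_mono (a b : 'I_q) : (a < b)%N -> (s a < s b)%N.
  move=> ab.
  have srt : sorted ltn (map val (enum S)).
    have -> : enum S = [seq x <- enum 'I_l | x \in S].
      by rewrite !enumT [LHS]/enum_mem.
    apply: (subseq_sorted ltn_trans (s2 := map val (enum 'I_l))).
      exact/map_subseq/filter_subseq.
    by rewrite val_enum_ord iota_ltn_sorted.
  have szE : size (enum S) = q by rewrite -cardE.
  have nthE (c : 'I_q) : val (s c) = nth 0%N (map val (enum S)) c.
    by rewrite (nth_map (i c)) ?szE // /s (enum_val_nth (i c)).
  rewrite -[nat_of_ord (s a)]/(val _) -[nat_of_ord (s b)]/(val _) !nthE.
  by apply: (sorted_ltn_nth ltn_trans 0%N srt) => //; rewrite inE size_map szE.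
have [a [b ab]] := Fy s s_mono.
have /imsetP[a' _ Ea] : s a \in S by exact: enum_valP.
have /imsetP[b' _ Eb] : s b \in S by exact: enum_valP.
by exists a', b'; rewrite -Ea -Eb.
Qed.

Lemma config_act (q : nat) (g : G) (y : cart_power Y l) :
  y \in config Y l q -> power_act g y \in config Y l q.
Proof.
rewrite !inE => /config_injP Fy; apply/config_injP => i inj_i.
exact: (Fy (shift g \o i) (inj_comp (@shift_inj g) inj_i)).
Qed.

Definition config_act_fun (q : nat) (g : G) (y : config_space Y l q) :
    config_space Y l q :=
  exist _ (power_act g (val y)) (config_act g (valP y)).

Lemma config_act1 (q : nat) (y : config_space Y l q) :
  config_act_fun 1%g y = y.
Proof. by apply: val_inj; exact: power_act1. Qed.

Lemma config_actM (q : nat) (g k : G) (y : config_space Y l q) :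
  config_act_fun (g * k)%g y = config_act_fun g (config_act_fun k y).
Proof. by apply: val_inj; exact: power_actM. Qed.

Definition config_action (q : nat) : left_action G (config_space Y l q) :=
  LeftAction (@config_act1 q) (@config_actM q).

End Action.

(* Main.v *)
Require Import Defs.
From HB Require Import structures.
From mathcomp Require Import all_boot all_fingroup.
From mathcomp Require Import all_classical topology.

(** A map [f] out of [X] corresponds to the equivariant map with components
    [x |-> f (g_j^-1 x)]; conversely [f] is recovered from an equivariant map
    as its component at the index of the identity of [G].  Under this
    correspondence the value at [x] avoids having [q] equal coordinates exactly
    when [f] avoids taking the same value at [q] distinct translates of [x]. *)

Lemma cart_power_continuous (X Y : topologicalType) (l : nat)
    (f : X -> cart_power Y l) :
  (forall j, continuous (fun x => f x j)) -> continuous f.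
Proof.
(* The product topology is the supremum of the initial topologies of the projections, so convergence
   is checked one coordinate at a time. *)
move=> cf x; apply/cvg_sup.
move=> j; move: x; apply: (@continuous_comp_initial _ _ _ (@^~ j) f).
exact: cf.
Qed.

Lemma config_space_continuous (X Y : topologicalType) (l q : nat)
    (f : X -> config_space Y l q) :
  continuous (fun x => val (f x)) -> continuous f.
Proof. by move=> cf; apply: continuous_comp_initial. Qed.

Lemma config_coord_continuous (Y : topologicalType) (l q : nat) (j : 'I_l) :
  continuous (fun y : config_space Y l q => val y j).
Proof.
move=> y; apply: (@continuous_comp (config_space Y l q) (cart_power Y l) Y
  val (proj j)).
  exact: initial_continuous.
exact: proj_continuous.
Qed.

Definition orbit_map {G : finGroupType} {l : nat} (e : enumeration G l)
    {X Y : topologicalType} (act : left_action G X) (f : X -> Y) (x : X) :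
  cart_power Y l := fun j => f (act (elt e j)^-1%g x).

Lemma orbit_map_continuous (G : finGroupType) (l : nat) (e : enumeration G l)
    (X Y : topologicalType) (act : left_action G X) (f : X -> Y) :
  (forall g, continuous (act g)) -> continuous f ->
  continuous (orbit_map e act f).
Proof.
move=> cact cf; apply: cart_power_continuous => j x.
by apply: continuous_comp; [exact: cact | exact: cf].
Qed.

(** This is why [orbit_map] uses inverses: [g_j^-1 g = (g^-1 g_j)^-1], so coordinate [j] at [g x] is
    the coordinate at [x] indexed by [g^-1 g_j]. *)
Lemma orbit_map_equivariant (G : finGroupType) (l : nat) (e : enumeration G l)
    (X Y : topologicalType) (act : left_action G X) (f : X -> Y) :
  equivariant act (power_action Y e) (orbit_map e act f).
Proof.
move=> g x; apply: funext => j.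
by rewrite /orbit_map /= /power_act /shift idxK invMg invgK lactM.
Qed.

Lemma orbit_map_config (G : finGroupType) (l q : nat) (e : enumeration G l)
    (X Y : topologicalType) (act : left_action G X) (f : X -> Y) (x : X) :
  ~ (exists u : 'I_q -> G,
       injective u /\ forall a b, f (act (u a) x) = f (act (u b) x)) ->
  config Y l q (orbit_map e act f x).
Proof.
(* With [config_injP] the indices need only be distinct, not increasing; the inverses of the
   elements they number are then [q] distinct elements of [G]. *)
move=> nu; apply/config_injP => i inj_i; apply: contrapT => nab; apply: nu.
exists (fun a => (elt e (i a))^-1)%g; split.
  by move=> a b /invg_inj/(can_inj (eltK e))/inj_i.
move=> a b; apply: contrapT => fab; apply: nab.
by exists a, b.
Qed.

(** Turns a coincidence of values along an orbit into a coincidence of coordinates at a single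
    point, as [g^-1 * 1 = g^-1]. *)
Lemma equivariant_coord {G : finGroupType} {l q : nat} {e : enumeration G l}
    {X Y : topologicalType} {act : left_action G X}
    {phi : X -> config_space Y l q} (g : G) (x : X) :
  equivariant act (config_action Y e q) phi ->
  val (phi (act g x)) (idx e 1%g) = val (phi x) (idx e g^-1%g).
Proof. by move=> ->; rewrite /= /power_act /shift idxK mulg1. Qed.

Theorem proposition2p2 (G : finGroupType) (l q : nat) (e : enumeration G l)
    (X Y : topologicalType) (act : left_action G X) :
  #|G| = l ->
  (2 <= q <= l)%N ->
  free_G_space act ->
  hausdorff_space Y ->
  ~ BUP Y act q <->
  exists phi : X -> config_space Y l q,
    continuous phi /\ equivariant act (config_action Y e q) phi.
Proof.
move=> _ _ [_ cact _] _; split.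
  move=> /existsNP[f /not_implyP[cf nf]].
  have conf x : orbit_map e act f x \in config Y l q.
    by rewrite inE; apply: orbit_map_config => -[u Hu]; apply: nf; exists x, u.
  exists (fun x => exist (fun y => y \in config Y l q) _ (conf x)); split.
    exact/config_space_continuous/orbit_map_continuous.
  by move=> g x; apply: val_inj; apply: orbit_map_equivariant.
move=> [phi [cphi ephi]] bup.
have cf : continuous (fun x => val (phi x) (idx e 1%g)).
  move=> x; apply: (@continuous_comp _ (config_space Y l q) Y phi
    (fun y => val y (idx e 1%g))); first exact: cphi.
  exact: config_coord_continuous.
have [x [u [inj_u fu]]] := bup _ cf.
have /set_mem/config_injP Fy := valP (phi x).
(* The value of the recovered map at [act (u a) x] is the coordinate of [phi x] indexed by the
   inverse of [u a]. These [q] indices are distinct, so [Fy] forbids all their coordinates to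
   agree. *)
have [|a [b]] := Fy (fun a => idx e (u a)^-1%g).
  by move=> a b /(can_inj (idxK e))/invg_inj/inj_u.
by apply; rewrite -!(equivariant_coord _ _ ephi); exact: fu.
Qed.
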